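(* Let $(\mathscr{G},d_{\mathscr{G}})$ be a complete separable metric semigroup, let $X_n:(\Omega,\mathscr{A},\mu)\to(\mathscr{G},\mathscr{B}_{\mathscr{G}})$, $n\geqslant 1$, be independent random variables, let $X\in L^0(\Omega,\mathscr{G})$, and let $S_n:=X_1X_2\cdots X_n$. Then $S_n\to X$ almost surely if and only if $S_n\to X$ in probability. Moreover, if the sequence $(S_n)$ does not converge in this sense (almost surely, equivalently in probability, to some $\mathscr{G}$-valued random variable), then it diverges almost surely.
   Context: A metric semigroup is a semigroup $(\mathscr{G},\cdot)$ (a set with an associative binary operation) equipped with a metric $d_{\mathscr{G}}:\mathscr{G}\times\mathscr{G}\to[0,\infty)$ that is translation-invariant: $d_{\mathscr{G}}(ac,bc)=d_{\mathscr{G}}(a,b)=d_{\mathscr{G}}(ca,cb)$ for all $a,b,c\in\mathscr{G}$. It need not be commutative nor have an identity. It is complete/separable if the metric space $(\mathscr{G},d_{\mathscr{G}})$ is. $(\Omega,\mathscr{A},\mu)$ is a probability space, $\mathscr{B}_{\mathscr{G}}$ is the Borel $\sigma$-algebra of $\mathscr{G}$, and $L^0(\Omega,\mathscr{G})$ is the set of $\mathscr{G}$-valued (Borel measurable) random variables. Convergence $S_n\to X$ in probability means $\mathbb{P}_\mu(d_{\mathscr{G}}(S_n,X)>\varepsilon)\to0$ for every $\varepsilon>0$. *)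

(* Defs.v *)
From HB Require Import structures.
From mathcomp Require Import all_boot all_order all_algebra finmap.
From mathcomp Require Import all_classical all_reals all_analysis.

Set Implicit Arguments.
Unset Strict Implicit.
Unset Printing Implicit Defensive.

Import Order.TTheory GRing.Theory Num.Theory.
Import numFieldNormedType.Exports.

Local Open Scope classical_set_scope.
Local Open Scope ring_scope.

HB.mixin Record isTranslationInvariant (R : realType) G
    & Metric R G & Semigroup G := {
  mdist_mulr : forall a b c : G, mdist (a * c)%g (b * c)%g = mdist a b :> R ;
  mdist_mull : forall a b c : G, mdist (c * a)%g (c * b)%g = mdist a b :> R
}.

#[short(type="metricSemigroupType")]
HB.structure Definition MetricSemigroup (R : realType) :=
  { G of Metric R G & Semigroup G & isTranslationInvariant R G }.

(* [Complete] also provides a distinguished point. This only says that G is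
   nonempty, as it must be to carry a random variable; no identity element is
   assumed. *)
#[short(type="completeMetricSemigroupType")]
HB.structure Definition CompleteMetricSemigroup (R : realType) :=
  { G of MetricSemigroup R G & Complete G }.

Definition separable (T : topologicalType) : Prop :=
  exists2 A : set T, countable A & dense A.

Notation borelType G := (g_sigma_algebraType (@open G)).

Definition mutually_independent (I : choiceType) (d d' : measure_display)
    (T : measurableType d) (T' : measurableType d') (R : realType)
    (P : probability T R) (X : I -> {RV P >-> T'}) : Prop :=
  forall (J : {fset I}) (B : I -> set T'),
    (forall i, i \in J -> measurable (B i)) ->
    P (\bigcap_(i in [set` J]) X i @^-1` B i)
    = (\prod_(i <- J) P (X i @^-1` B i))%E.

(* Indices start at 0: for a sequence x_1, x_2, ... given by [x 0], [x 1], ...,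
   [prefix_prod x n] is x_1 x_2 ... x_{n+1}. There is no empty product, since a
   semigroup need not have an identity. *)
Fixpoint prefix_prod (G : semigroupType) (x : nat -> G) (n : nat) : G :=
  if n is m.+1 then (prefix_prod x m * x m.+1)%g else x 0%N.

Section modes_of_convergence.
Context (d : measure_display) (T : measurableType d) (R : realType).
Context (P : probability T R) (G : metricType R).

Definition cvg_almost_surely (S : nat -> T -> G) (X : T -> G) : Prop :=
  {ae P, forall w, S n w @[n --> \oo] --> X w}.

Definition cvg_in_probability (S : nat -> T -> G) (X : T -> G) : Prop :=
  forall e : R, 0 < e ->
    P [set w | e < mdist (S n w) (X w)] @[n --> \oo] --> 0%E.

Definition diverges_almost_surely (S : nat -> T -> G) : Prop :=
  {ae P, forall w, ~ exists l : G, S n w @[n --> \oo] --> l}.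

End modes_of_convergence.

(* Main.v *)
From HB Require Import structures.
Require Import Defs.
From mathcomp Require Import all_boot all_order all_algebra finmap zify lra.
From mathcomp Require Import all_classical all_reals all_analysis.
From mathcomp Require Import measurable_realfun.

Set Implicit Arguments.
Unset Strict Implicit.
Unset Printing Implicit Defensive.

Import Order.TTheory GRing.Theory Num.Theory.

Local Open Scope classical_set_scope.
Local Open Scope ring_scope.

(** Translation invariance makes [d(a, a t)] independent of [a]
    ([mdist_mulr_self]): it is [d(t, t t)], a measurement of the right factor
    [t] alone. As [S_n = S_k (X_{k+1} ... X_n)], the displacement [d(S_k, S_n)]
    is a function of [X_{k+1}, ..., X_n], hence independent of
    [X_1, ..., X_k]. This plays the role that the difference [S_n - S_k] plays
    for sums, and the classical arguments of Levy and Kolmogorov go through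
    with neither an identity nor commutativity.

    Convergence in probability implies almost sure convergence. Being Cauchy in
    probability, [S] has all its displacements [d(S_i, S_j)] with [i, j >= m]
    at most [e] up to probability [q]. Stop at the first [k] for which
    [d(S_m, S_{m+k}) > 2e]; independently of the past, [S] is then still within
    [e] of its present position at time [m + N] with probability at least
    [1 - q], and in that case [d(S_m, S_{m+N}) > e], which has probability at
    most [q]. This is Ottaviani's inequality ([first_passage_bound],
    [ottaviani]); it bounds the probability that [S] ever gets farther than
    [2e] from [S_m], and hence the probability that [S] is infinitely often far
    from [X] ([cvg_in_probability_almost_surely]). The converse is continuity
    of the measure from above, and holds for all random sequences
    ([cvg_almost_surely_in_probability]).

    Divergence is a zero-one law. By completeness, convergence is the Cauchy
    property; removing the first factors of [S] is a left translation, which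
    preserves distances, so the Cauchy event belongs to the tail sigma-algebra
    of the [X_n] and has probability 0 or 1 ([cauchy_zero_one]). If it is 1,
    the pointwise limit is a random variable to which [S] converges almost
    surely; otherwise [S] diverges almost surely.

    The independence of sigma-algebras generated by disjoint blocks of the
    [X_n] comes from the pi-lambda theorem applied to finite-dimensional
    cylinders ([independent_blocks]). Separability makes the product and the
    distance of two random elements measurable ([borel_map_pair]). *)

(** * Increments in a metric semigroup *)

Section metric_semigroup.
Context (R : realType) (G : metricSemigroupType R).
Implicit Types (a t : G) (x : nat -> G).

(** Both sides equal [mdist (a * t) (a * t * t)]: translate the left one by [t]
    on the right, the right one by [a] on the left. *)
Lemma mdist_mulr_self a t : mdist a (a * t)%g = mdist t (t * t)%g.
Proof.
by rewrite -(mdist_mulr _ _ t) -mulgA mdist_mull.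
Qed.

Lemma prefix_prod_shift x k j :
  prefix_prod x (k.+1 + j) =
  (prefix_prod x k * prefix_prod (fun i => x (k.+1 + i)%N) j)%g.
Proof.
elim: j => [|j IHj]; first by rewrite addn0 /= addn0.
rewrite addnS [LHS]/(prefix_prod x (k.+1 + j) * x (k.+1 + j).+1)%g.
by rewrite IHj [in RHS]/= addnS mulgA.
Qed.

(** Dropping the first factors is a left translation, so it changes no distance
    between the remaining products. *)
Lemma mdist_prefix_prod_shift x k i j :
  mdist (prefix_prod x (k.+1 + i)) (prefix_prod x (k.+1 + j)) =
  mdist (prefix_prod (fun i => x (k.+1 + i)%N) i)
        (prefix_prod (fun i => x (k.+1 + i)%N) j).
Proof. by rewrite !prefix_prod_shift mdist_mull. Qed.

(** The right-hand side involves only the coordinates of [x] beyond [k]: for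
    random factors it is independent of everything up to time [k]. *)
Lemma mdist_prefix_prod x k j :
  let t := prefix_prod (fun i => x (k.+1 + i)%N) j in
  mdist (prefix_prod x k) (prefix_prod x (k.+1 + j)) = mdist t (t * t)%g.
Proof. by move=> t; rewrite prefix_prod_shift mdist_mulr_self. Qed.

End metric_semigroup.

(** * Measurability of maps into a separable metric space *)

Section separable_measurability.
Context (d : measure_display) (T : measurableType d) (R : realType).

(** In a separable space an open set is the union of the countably many balls
    that it contains and that have their centre in the dense set and radius
    [1/(n+1)]; it is enough to test measurability on these. *)
Lemma countable_dense_ball_preimage_measurable (V : pseudoMetricType R)
    (A : set V) (f : T -> V) :
  countable A -> dense A ->
  (forall a r, A a -> 0 < r -> measurable (f @^-1` ball a r)) ->
  forall U, open U -> measurable (f @^-1` U).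
Proof.
move=> /pfcard_geP[A0|[a]] dA mf U oU.
  have [->|/set0P U0] := eqVneq U set0; first by rewrite preimage_set0.
  by have := dA _ U0 oU; rewrite A0 setI0 => -[].
pose K (p : nat * nat) := ball (a p.1) p.2.+1%:R^-1 `<=` U.
have -> : f @^-1` U = \bigcup_(p : nat * nat)
    (if `[< K p >] then f @^-1` ball (a p.1) p.2.+1%:R^-1 else set0).
  apply/seteqP; split=> [w /= Ufw|w [p _]]; last first.
    by case: ifPn => // /asboolP Kp; exact: Kp.
  have /nbhs_ballP[e /= e0 eU] : nbhs (f w) U by exact: open_nbhs_nbhs.
  (* radius below [e / 2]: the ball around the dense point must contain [f w]
     and still fit in the ball of radius [e] around [f w] *)
  have [n _ ne] := near_infty_natSinv_lt (PosNum (divr_gt0 e0 (ltr0n R 2))).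
  have /= {}ne := ne n (leqnn n).
  have n0 : (0 : R) < n.+1%:R^-1 by rewrite invr_gt0 ltr0n.
  have [|z [bz Az]] :=
      dA (interior (ball (f w) n.+1%:R^-1)) _ (@open_interior _ _).
    by exists (f w); exact: nbhsx_ballx.
  have [k _ akz] := @surj _ _ _ _ a _ Az.
  exists (k, n) => //=.
  have bw : ball z n.+1%:R^-1 (f w).
    by apply: ball_sym; exact: interior_subset bz.
  have -> : `[< K (k, n) >]; last by rewrite akz.
  apply/asboolP => y /=; rewrite akz => zy; apply: eU.
  rewrite [e]splitr; apply: (@le_ball _ _ _ (n.+1%:R^-1 + n.+1%:R^-1)).
    by rewrite lerD// ltW.
  by apply: ball_triangle zy; exact: interior_subset bz.
apply: countable_bigcupT_measurable => // -[k n] /=.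
case: ifP => // _; apply: mf; first exact: (@funS _ _ _ _ a).
by rewrite invr_gt0 ltr0n.
Qed.

Lemma open_mdist_gt (G : metricType R) (e : R) :
  open [set p : G * G | e < mdist p.1 p.2].
Proof.
rewrite openE => -[x y] /= exy; apply/nbhs_ballP.
exists ((mdist x y - e) / 2); first by rewrite /= divr_gt0// subr_gt0.
move=> [u v] [/=]; rewrite !ballEmdist /= => xu yv.
have := metric_triangle x u y; have := metric_triangle u v y.
rewrite (metric_sym v y); lra.
Qed.

Lemma open_mdist_lt (G : metricType R) (a : G) (r : R) :
  open [set x : G | mdist a x < r].
Proof.
rewrite openE => x /= axr; apply/nbhs_ballP.
exists (r - mdist a x); first by rewrite /= subr_gt0.
move=> y; rewrite ballEmdist /= => xy; have := metric_triangle a x y; lra.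
Qed.

End separable_measurability.

(** Borel measurability, phrased with open sets so that the sigma-algebra on the
    source can vary for a fixed map: the argument uses the sigma-algebras that
    blocks of the [X_n] generate on one probability space. *)
Definition borel_map d (T : measurableType d) (V : topologicalType)
  (f : T -> V) := forall U, open U -> measurable (f @^-1` U).

Section metric_valued.
Context (d : measure_display) (T : measurableType d) (R : realType).
Context (G : metricType R).
Hypothesis sepG : separable G.
Implicit Types f g : T -> G.

(** Separability makes every open set of [G * G] a countable union of products
    of balls, whose preimages are intersections of preimages under [f] and
    [g]. *)
Lemma borel_map_pair f g :
  borel_map f -> borel_map g -> borel_map (fun w => (f w, g w)).
Proof.
move=> mf mg.
have mball (h : T -> G) a r : borel_map h -> measurable (h @^-1` ball a r).
  by move=> mh; apply: mh; rewrite ballEmdist; exact: open_mdist_lt.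
have [A cA dA] := sepG.
apply: (@countable_dense_ball_preimage_measurable _ _ _ _ (A `*` A)) => //.
- exact: countableX.
- move=> O [[x y] Oxy] oO.
  have /nbhs_ballP[e /= e0 eO] : nbhs (x, y) O by exact: open_nbhs_nbhs.
  (* nonemptiness of [O] provides a ball inside [O], met by [A `*` A] one
     coordinate at a time *)
  have dA' z : exists2 a, A a & mdist z a < e.
    have [|a [/= za Aa]] :=
        dA [set a | mdist z a < e] _ (@open_mdist_lt _ _ _ _).
      by exists z; rewrite /= mdistxx.
    by exists a.
  have [a Aa xa] := dA' x; have [b Ab yb] := dA' y.
  exists (a, b); split=> //; apply: eO.
  by split; rewrite /= ballEmdist.
- move=> [a b] r _ r0.
  have -> : (fun w => (f w, g w)) @^-1` ball (a, b) r =
     (f @^-1` ball a r) `&` (g @^-1` ball b r) by [].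
  by apply: measurableI; exact: mball.
Qed.

Lemma measurable_mdist_gt f g (e : R) : borel_map f -> borel_map g ->
  measurable [set w | e < mdist (f w) (g w)].
Proof.
move=> mf mg; have mfg := borel_map_pair mf mg.
exact: (mfg [set p | e < mdist p.1 p.2] (@open_mdist_gt _ _ _)).
Qed.

(** Reduces to real-valued limits: the preimage of a ball centred at [a] is a
    sublevel set of [mdist a (g w)], the limit of [mdist a (f n w)]. *)
Lemma borel_map_lim (f : nat -> T -> G) g :
  (forall n, borel_map (f n)) ->
  (forall w, f n w @[n --> \oo] --> g w) ->
  borel_map g.
Proof.
move=> mf fg; have [A cA dA] := sepG.
apply: (@countable_dense_ball_preimage_measurable _ _ _ _ A) => // a r _ r0.
have mdf n : measurable_fun setT (fun w => mdist a (f n w)).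
  apply: (measurability _ (RGenInftyO.measurableE R)) => // _ [_ [s ->] <-].
  have := mf n [set x | mdist a x < s] (@open_mdist_lt _ _ _ _).
  by rewrite setTI; congr (measurable _); apply/seteqP; split=> w /=;
    rewrite in_itv.
have mdg : measurable_fun setT (fun w => mdist a (g w)).
  apply: measurable_fun_cvg mdf _ => w _; apply/cvgrPdist_lt => e e0.
  have /metricType_numDomainType.cvgrPdist_lt/(_ e e0) := fg w.
  apply: filterS => n gf.
  have := metric_triangle a (f n w) (g w).
  have := metric_triangle a (g w) (f n w).
  rewrite (metric_sym (f n w)) ltr_norml => h1 h2; apply/andP; split; lra.
rewrite ballEmdist; have := mdg measurableT _ (measurable_itv `]-oo, r[).
by rewrite setTI; congr (measurable _); apply/seteqP; split=> w /=; rewrite in_itv.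
Qed.

End metric_valued.

(** Multiplication is 1-Lipschitz in each variable, hence continuous on the
    product. *)
Lemma borel_map_mul d (T : measurableType d) (R : realType)
    (G : metricSemigroupType R) (f g : T -> G) :
  separable G -> borel_map f -> borel_map g ->
  borel_map (fun w => f w * g w)%g.
Proof.
move=> sepG mf mg U oU.
apply: (borel_map_pair sepG mf mg (U := [set p : G * G | U (p.1 * p.2)%g])).
rewrite openE => -[a b] /= Uab.
have /nbhs_ballP[e /= e0 eU] : nbhs (a * b)%g U by exact: open_nbhs_nbhs.
apply/nbhs_ballP; exists (e / 2); first exact: divr_gt0.
move=> [u v] [/=]; rewrite !ballEmdist /= => au bv; apply: eU.
rewrite ballEmdist /=.
have := metric_triangle (a * b)%g (u * b)%g (u * v)%g.
rewrite mdist_mulr mdist_mull; lra.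
Qed.

Lemma borel_map_prefix_prod d (T : measurableType d) (R : realType)
    (G : metricSemigroupType R) (x : nat -> T -> G) n :
  separable G -> (forall i, (i <= n)%N -> borel_map (x i)) ->
  borel_map (fun w => prefix_prod (x ^~ w) n).
Proof.
move=> sepG; elim: n => [|n IHn] mx; first exact: mx.
apply: borel_map_mul => //; last exact: mx.
by apply: IHn => i /leqW; exact: mx.
Qed.

Lemma measurable_fun_borelP d (T : measurableType d) (R : realType)
    (G : completeMetricSemigroupType R) (f : T -> borelType G) :
  measurable_fun setT f <-> borel_map (f : T -> G).
Proof.
split=> [mf U oU|mf].
  by rewrite -[X in measurable X]setTI; apply: mf => //; exact: sub_sigma_algebra.
apply: (@measurability _ _ T (borelType G) setT f (@open G)) => // _ [U oU <-].
by rewrite setTI; exact: mf.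
Qed.

(** * Independence of blocks and the zero-one law *)

Section independence.
Context (d : measure_display) (T : measurableType d) (R : realType).
Context (P : probability T R).

(** The events independent of [C] form a Dynkin class, so the pi-lambda theorem
    extends independence from [F] to the sigma-algebra that it generates. *)
Lemma independent_sigma (F : set (set T)) (C : set T) :
  setI_closed F -> F `<=` measurable -> measurable C ->
  (forall U, F U -> P (U `&` C) = P U * P C)%E ->
  forall U, <<s F >> U -> P (U `&` C) = (P U * P C)%E.
Proof.
move=> FI mF mC FC.
pose H := [set U | measurable U /\ P (U `&` C) = (P U * P C)%E].
suff FH : <<s F >> `<=` H by move=> U /FH[].
apply: lambda_system_subset => //; last first.
  by move=> U FU; split; [exact: mF|exact: FC].
apply/dynkin_lambda_system; split.
- by split=> //; rewrite setTI probability_setT mul1e.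
- move=> U [mU UC]; split; first exact: measurableC.
  have -> : ~` U `&` C = C `\` (U `&` C).
    by apply/seteqP; split=> w /=; rewrite not_andE; tauto.
  have -> : P (C `\` (U `&` C)) = (P C - P (C `&` (U `&` C)))%E.
    apply: measureD; [by []|exact: measurableI|].
    by rewrite ltey_eq fin_num_measure.
  rewrite setICA setIid UC probability_setC // muleBl ?mul1e //.
  exact: fin_num_measure.
- move=> D tD HD; split.
    by apply: bigcup_measurable => n _; have [] := HD n.
  have mD n : measurable (D n) by have [] := HD n.
  rewrite setI_bigcupl !measure_bigcup //; last 2 first.
  + by move=> n _; exact: measurableI.
  + exact: trivIset_setIr.
  rewrite muleC -(fineK (fin_num_measure P C mC)) -nneseriesZl //.
  apply: eq_eseriesr => n _; rewrite fineK ?fin_num_measure // muleC.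
  by have [] := HD n.
Qed.

Context (I : choiceType) (d' : measure_display) (T' : measurableType d').
Variable X : I -> {RV P >-> T'}.
Implicit Types A : set I.

(** The finite-dimensional cylinders over the coordinates in [A], a pi-system
    generating the sigma-algebra of the block [X i], [i] in [A]. *)
Definition cylinders A : set (set T) :=
  [set U | exists (J : {fset I}) (B : I -> set T'),
    [/\ [set` J] `<=` A, forall i, measurable (B i) &
        U = \bigcap_(i in [set` J]) X i @^-1` B i]].

Lemma cylinder_measurable A : cylinders A `<=` measurable.
Proof.
move=> _ [J [B [_ mB ->]]]; apply: fin_bigcap_measurable => // i _.
by rewrite -[X in measurable X]setTI; exact: measurable_funPT.
Qed.

Lemma sub_cylinders A A' : A `<=` A' -> cylinders A `<=` cylinders A'.
Proof.
by move=> AA' _ [J [B [JA mB ->]]]; exists J, B; split=> // i /JA/AA'.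
Qed.

Lemma preimage_cylinder A i (B : set T') :
  A i -> measurable B -> cylinders A (X i @^-1` B).
Proof.
move=> Ai mB; exists [fset i]%fset, (fun=> B); split=> //.
  by move=> j /=; rewrite inE => /eqP ->.
apply/seteqP; split=> [w Bw j /=|w]; first by rewrite inE => /eqP ->.
by apply; rewrite /= inE.
Qed.

Lemma cylinders_setI A : setI_closed (cylinders A).
Proof.
move=> _ _ [J [B [JA mB ->]]] [K [C [KA mC ->]]].
exists (J `|` K)%fset, (fun i => (if i \in J then B i else setT) `&`
                                 (if i \in K then C i else setT)).
split.
- by move=> i /=; rewrite inE => /orP[/JA|/KA].
- by move=> i; apply: measurableI; case: ifP.
- apply/seteqP; split=> [w [Jw Kw] i _ /=|w JKw].
    by split; case: ifPn => // ?; [exact: Jw|exact: Kw].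
  split=> i /= iJK; have /= := JKw i; rewrite inE iJK ?orbT => /(_ isT)[//].
Qed.

Hypothesis indX : mutually_independent X.

Lemma independent_cylinders A A' U V : A `&` A' = set0 ->
  cylinders A U -> cylinders A' V -> P (U `&` V) = (P U * P V)%E.
Proof.
move=> AA' [J [B [JA mB ->]]] [K [C [KA mC ->]]].
have JK i : i \in J -> i \in K = false.
  move=> iJ; apply/negbTE/negP => iK.
  by have : (A `&` A') i by [split; [exact: JA|exact: KA]]; rewrite AA'.
pose E i := if i \in J then B i else C i.
have -> : \bigcap_(i in [set` J]) X i @^-1` B i `&`
          \bigcap_(i in [set` K]) X i @^-1` C i =
          \bigcap_(i in [set` (J `|` K)%fset]) X i @^-1` E i.
  apply/seteqP; split=> [w [Jw Kw] i /=|w JKw].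
    rewrite inE /E; case: ifPn => /= [iJ _|_ iK]; [exact: Jw|exact: Kw].
  split=> i /= iJK; have /= := JKw i; rewrite inE iJK ?orbT => /(_ isT);
    rewrite /E ?iJK//.
  by case: ifPn => // /JK; rewrite iJK.
rewrite !indX //; last by move=> i _; rewrite /E; case: ifP.
(* [J] and [K] are disjoint, so the product over their union splits *)
rewrite (perm_big (J ++ K)) /=; last first.
  apply: uniq_perm; rewrite ?fset_uniq //.
    rewrite cat_uniq !fset_uniq /= andbT; apply/hasPn => i iK.
    by apply/negP => /JK; rewrite iK.
  by move=> i; rewrite mem_cat inE.
rewrite big_cat /=; congr (_ * _)%E.
  by apply: eq_big_seq => i iJ; rewrite /E iJ.
apply: eq_big_seq => i iK; rewrite /E; case: ifPn => // /JK.
by rewrite iK.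
Qed.

(** The pi-lambda theorem is used twice, first in [V] against a fixed cylinder
    [U], then in [U] against a fixed event [V]. *)
Lemma independent_blocks A A' U V : A `&` A' = set0 ->
  <<s cylinders A >> U -> <<s cylinders A' >> V ->
  P (U `&` V) = (P U * P V)%E.
Proof.
move=> AA' sU sV.
have mV : measurable V.
  apply: (smallest_sub _ (@cylinder_measurable A')) sV.
  exact: sigma_algebra_measurable.
apply: (independent_sigma (@cylinders_setI A)) sU => //.
  exact: cylinder_measurable.
move=> {}U cU; rewrite setIC muleC.
apply: (independent_sigma (@cylinders_setI A')) sV.
- exact: cylinder_measurable.
- exact: cylinder_measurable cU.
- by move=> W cW; rewrite setIC muleC; exact: independent_cylinders AA' cU cW.
Qed.

End independence.

(** A cylinder depends on finitely many coordinates, hence is independent of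
    [C], which can be expressed by later ones. These cylinders generate a
    sigma-algebra containing [C] itself, so [C] is independent of itself and
    [P C = P C * P C]. *)
Lemma kolmogorov_zero_one d (T : measurableType d) (R : realType)
    (P : probability T R) d' (T' : measurableType d')
    (X : nat -> {RV P >-> T'}) (C : set T) :
  mutually_independent X ->
  (forall n, <<s cylinders X [set i | (n <= i)%N] >> C) ->
  P C = 0%E \/ P C = 1%E.
Proof.
move=> indX tC.
have mC : measurable C.
  apply: (smallest_sub _ (@cylinder_measurable _ _ _ P _ _ _ X _)) (tC 0%N).
  exact: sigma_algebra_measurable.
have PCC : P (C `&` C) = (P C * P C)%E.
  pose C0 := @cylinders_setI _ _ _ P _ _ _ X [set i | (0 <= i)%N].
  apply: (independent_sigma C0) (tC 0%N) => //.
    exact: cylinder_measurable.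
  move=> U [J [B [_ mB ->]]].
  (* every index of the cylinder is below [n] *)
  pose n := (\max_(i <- J) i).+1.
  apply: (independent_blocks indX (A := [set i | (i < n)%N])) (tC n).
    by apply/seteqP; split=> // i [/= + ni]; rewrite ltnNge ni.
  apply: sub_sigma_algebra; exists J, B; split=> // i /= iJ.
  by rewrite ltnS; apply: leq_bigmax_seq.
move: PCC; rewrite setIid.
rewrite -(fineK (fin_num_measure P C mC)).
move: (fine (P C)) => p [] /eqP.
rewrite -subr_eq0 -{1}(mulr1 p) -mulrBr mulf_eq0 => /orP[/eqP ->|].
  by left.
by rewrite subr_eq0 => /eqP <-; right.
Qed.

(** * Ottaviani's maximal inequality *)

(** [seqDU A k] is the event that [k] is the first index at which [A] occurs.
    These events are disjoint; on each of them the independent event [D k], of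
    probability at least [c], forces [B]. *)
Lemma first_passage_bound d (T : measurableType d) (R : realType)
    (P : probability T R) (A D : nat -> set T) (B : set T) (c : R) N :
  0 <= c -> (forall k, measurable (A k)) -> (forall k, measurable (D k)) ->
  measurable B ->
  (forall k, (k < N)%N ->
    P (seqDU A k `&` D k) = P (seqDU A k) * P (D k))%E ->
  (forall k, (k < N)%N -> A k `&` D k `<=` B) ->
  (forall k, (k < N)%N -> c%:E <= P (D k))%E ->
  (c%:E * P (\big[setU/set0]_(k < N) A k) <= P B)%E.
Proof.
move=> c0 mA mD mB ind AD cD.
have mF k : measurable (seqDU A k) by exact: seqDU_measurable.
have -> : P (\big[setU/set0]_(k < N) A k) = (\sum_(k < N) P (seqDU A k))%E.
  rewrite bigsetU_seqDU; apply: measure_bigsetU => //; exact: trivIset_seqDU.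
rewrite ge0_sume_distrr //.
apply: (@le_trans _ _ (\sum_(k < N) P (seqDU A k `&` D k))%E).
  apply: lee_sum => k _; rewrite ind // muleC.
  by apply: lee_pmul => //; exact: cD.
have <- : P (\big[setU/set0]_(k < N) (seqDU A k `&` D k)) =
          (\sum_(k < N) P (seqDU A k `&` D k))%E.
  apply: (measure_bigsetU P (F := fun k => seqDU A k `&` D k)).
    by move=> k; exact: measurableI.
  apply/trivIsetP => i j _ _ ij; rewrite setIACA.
  by have /trivIsetP -> := @trivIset_seqDU _ A; rewrite ?set0I.
apply: le_measure; rewrite ?inE //.
  by apply: bigsetU_measurable => k _; exact: measurableI.
move=> w; rewrite -(bigcup_mkord N (fun k => seqDU A k `&` D k)).
move=> -[k /= kN [Fk Dk]].
by apply: (AD k kN); split=> //; exact: subset_seqDU Fk.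
Qed.

(** * Modes of convergence *)

Section convergence_modes.
Context (d : measure_display) (T : measurableType d) (R : realType).
Context (P : probability T R).

Lemma measure_bigcup_le (A : nat -> set T) (b : \bar R) :
  (forall k, measurable (A k)) ->
  (forall N, P (\big[setU/set0]_(k < N) A k) <= b)%E ->
  (P (\bigcup_k A k) <= b)%E.
Proof.
move=> mA Ab; rewrite -bigcup_bigsetU_bigcup.
apply: (cvge_to_le (nondecreasing_cvg_mu _ _ _)) => /=.
- by move=> n; exact: bigsetU_measurable.
- by apply: bigcup_measurable => n _; exact: bigsetU_measurable.
- by move=> n m nm; apply/subsetPset; exact: subset_bigsetU.
- by apply: nearW => n; exact: Ab.
Qed.

Context (G : metricType R) (S : nat -> T -> G) (X : T -> G).
Hypothesis mfar : forall n e, measurable [set w | e < mdist (S n w) (X w)].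

(** The events that [S] is [e]-far from [X] at some time after [n] decrease with
    [n], and their intersection misses every point of convergence. *)
Lemma cvg_almost_surely_in_probability :
  cvg_almost_surely P S X -> cvg_in_probability P S X.
Proof.
move=> SX e e0.
pose E k := [set w | e < mdist (S k w) (X w)].
pose F n := \bigcup_k E (n + k)%N.
have mF n : measurable (F n) by apply: bigcup_measurable => k _; exact: mfar.
have mcapF : measurable (\bigcap_n F n) by exact: bigcapT_measurable.
have capF0 : P (\bigcap_n F n) = 0%E.
  apply/negligibleP => //; apply: negligibleS SX => w Fw /= Sw.
  have /metricType_numDomainType.cvgrPdist_lt/(_ e e0)[N _ NS] := Sw.
  have [k _] := Fw N I; rewrite /E /= metric_sym ltNge => /negP; apply.
  by apply/ltW/NS; exact: leq_addr.
have : P (F n) @[n --> \oo] --> P (\bigcap_n F n).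
  apply: nonincreasing_cvg_mu => //.
    by rewrite ltey_eq fin_num_measure.
  move=> n m nm; apply/subsetPset => w [k _ Ek]; exists (m - n + k)%N => //.
  by rewrite addnA subnKC.
rewrite capF0; apply: squeeze_cvge (@cvg_cst _ _ _ _ _) => //.
apply: nearW => n; rewrite measure_ge0 /=; apply: le_measure; rewrite ?inE //.
by move=> w Ew; exists 0%N => //; rewrite addn0.
Qed.

(** Countably many thresholds [1/(n+1)] suffice, so the exceptional null sets
    can be united. *)
Lemma cvg_almost_surely_limsup0 :
  (forall e, 0 < e ->
    P (\bigcap_m \bigcup_k [set w | e < mdist (S (m + k)%N w) (X w)]) = 0%E) ->
  cvg_almost_surely P S X.
Proof.
move=> io0.
pose L e := \bigcap_m \bigcup_k [set w | e < mdist (S (m + k)%N w) (X w)].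
have mL e : measurable (L e).
  by apply: bigcapT_measurable => m; apply: bigcup_measurable => k _; exact: mfar.
have : \forall w \ae P, forall n : nat, ~ L n.+1%:R^-1 w.
  apply: ae_foralln => n; rewrite /almost_everywhere.
  apply: (@negligibleS _ _ _ P (L n.+1%:R^-1)); first by move=> w /contrapT.
  by apply/negligibleP => //; apply: io0; rewrite invr_gt0 ltr0n.
apply: filterS => w Lw.
apply/metricType_numDomainType.cvgrPdist_lt => e e0.
have [n _ ne] := near_infty_natSinv_lt (PosNum e0).
have /= {}ne := ne n (leqnn n).
have := Lw n; rewrite /L => /existsNP[m /not_implyP[_ mL']].
exists m => // k /= mk; rewrite metric_sym; apply: le_lt_trans ne.
rewrite leNgt; apply/negP => h; apply: mL'; exists (k - m)%N => //.
by rewrite subnKC.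
Qed.

End convergence_modes.

(** * The Cauchy event *)

(** Thresholds [1/(p+1)] and natural indices only, so that the Cauchy property
    is visibly a countable combination of conditions on distances. *)
Definition cauchy_sequence (R : realType) (G : metricType R) (s : nat -> G) :=
  forall p : nat, exists m, forall i j,
    mdist (s (m + i)%N) (s (m + j)%N) <= p.+1%:R^-1.

Lemma cauchy_sequenceP (R : realType) (G : completeMetricSemigroupType R)
    (s : nat -> G) :
  cauchy_sequence s <-> exists l : G, s n @[n --> \oo] --> l.
Proof.
split=> [cs|[l sl] p].
  suff : cvg (s n @[n --> \oo]) by move=> /cvg_ex.
  apply: cauchy_cvg; apply/cauchyP => e e0.
  have [p _ pe] := near_infty_natSinv_lt (PosNum e0).
  have /= {}pe := pe p (leqnn p).
  have [m sm] := cs p; exists (s m); exists m => // n /= mn.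
  rewrite ballEmdist /=; apply: le_lt_trans pe.
  by have := sm 0%N (n - m)%N; rewrite addn0 subnKC.
have : 0 < p.+1%:R^-1 :> R by rewrite invr_gt0.
move: (p.+1%:R^-1) => r r0; have p0 : 0 < r / 2 by rewrite divr_gt0.
have /metricType_numDomainType.cvgrPdist_lt/(_ _ p0)[m _ sm] := sl.
exists m => i j; have /= := sm _ (leq_addr i m); have /= := sm _ (leq_addr j m).
have := metric_triangle (s (m + i)%N) l (s (m + j)%N).
rewrite (metric_sym _ l); lra.
Qed.

Lemma cauchy_prefix_prod_shift (R : realType) (G : metricSemigroupType R)
    (x : nat -> G) k :
  cauchy_sequence (prefix_prod x) <->
  cauchy_sequence (prefix_prod (fun i => x (k.+1 + i)%N)).
Proof.
split=> cx p; have [m xm] := cx p.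
  exists m => i j; rewrite -mdist_prefix_prod_shift.
  by rewrite !(addnCA _ m); exact: xm.
by exists (k.+1 + m)%N => i j; rewrite -!addnA mdist_prefix_prod_shift.
Qed.

Lemma measurable_cauchy d (T : measurableType d) (R : realType)
    (G : metricType R) (s : nat -> T -> G) :
  separable G -> (forall n, borel_map (s n)) ->
  measurable [set w | cauchy_sequence (s ^~ w)].
Proof.
move=> sepG ms.
have -> : [set w | cauchy_sequence (s ^~ w)] =
    \bigcap_p \bigcup_m \bigcap_i \bigcap_j
      ~` [set w | p.+1%:R^-1 < mdist (s (m + i)%N w) (s (m + j)%N w)].
  apply/seteqP; split=> w cw p.
    move=> _; have [m sm] := cw p; exists m => // i _ j _ /=.
    by apply/negP; rewrite -leNgt.
  have [m _ sm] := cw p I; exists m => i j; rewrite leNgt; apply/negP.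
  exact: sm i I j I.
apply: bigcapT_measurable => p; apply: bigcup_measurable => m _.
apply: bigcapT_measurable => i; apply: bigcapT_measurable => j.
by apply: measurableC; exact: measurable_mdist_gt.
Qed.

(** * Products of independent random variables *)

Section random_products.
Context (R : realType) (G : completeMetricSemigroupType R).
Context (d : measure_display) (Omega : measurableType d).
Context (mu : probability Omega R) (X_ : nat -> {RV mu >-> borelType G}).
Hypotheses (sepG : separable G) (indX : mutually_independent X_).

Let x (w : Omega) k : G := X_ k w.
Let S n w := prefix_prod (x w) n.
Let tail k j w := prefix_prod (fun i => x w (k.+1 + i)%N) j.
Let gap e i j := [set w | e < mdist (S i w) (S j w)].
Let block (A : set nat) := g_sigma_algebraType (cylinders X_ A).

Let mS n : borel_map (S n).
Proof.
apply: borel_map_prefix_prod => // i _; apply/measurable_fun_borelP.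
exact: measurable_funPT.
Qed.

Let block_coordinate A i : A i -> @borel_map _ (block A) G (x ^~ i).
Proof.
move=> Ai U oU; apply: sub_sigma_algebra; apply: preimage_cylinder => //.
exact: sub_sigma_algebra.
Qed.

Let block_tail k j : @borel_map _ (block [set i | (k < i)%N]) G (tail k j).
Proof.
apply: (@borel_map_prefix_prod _ (block _) _ _
  (fun i w => x w (k.+1 + i)%N)) => // i _.
by apply: block_coordinate; rewrite /= leq_addr.
Qed.

Let past_increment n i j e : (i <= n)%N -> (j <= n)%N ->
  <<s cylinders X_ [set i | (i <= n)%N] >> (gap e i j).
Proof.
move=> ilen jlen.
have mp k : (k <= n)%N ->
    @borel_map _ (block [set i | (i <= n)%N]) G (S k).
  move=> kn.
  apply: (@borel_map_prefix_prod _ (block _) _ _ (fun i w => x w i)) => // l lk.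
  by apply: block_coordinate; exact: leq_trans lk kn.
exact: (@measurable_mdist_gt _ (block _) _ _ sepG _ _ e (mp i ilen) (mp j jlen)).
Qed.

(** The distance between [S k] and [S (k.+1 + j)] does not see the coordinates up
    to [k], although both points do. *)
Let future_increment k j e :
  <<s cylinders X_ [set i | (k < i)%N] >>
  (gap e k (k.+1 + j)).
Proof.
have -> : gap e k (k.+1 + j) =
          [set w | e < mdist (tail k j w) (tail k j w * tail k j w)%g].
  by apply/seteqP; split=> w; rewrite /gap /mkset /S mdist_prefix_prod.
apply: (@measurable_mdist_gt _ (block _) _ _ sepG (tail k j)
  (fun w => tail k j w * tail k j w)%g e) => //.
by apply: borel_map_mul.
Qed.

Let measurable_gap e i j : measurable (gap e i j).
Proof. exact: measurable_mdist_gt. Qed.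

(** With probability at least [1 - q >= 1/2], whatever happened before, [S] is
    at time [m + N] within [e] of where it first left the ball of radius [2e]
    around [S m]; then it is still at distance more than [e] from [S m]. *)
Lemma ottaviani m (N : nat) (e q : R) : q <= 2^-1 ->
  (forall i j, (m <= i)%N -> (m <= j)%N ->
    mu (gap e i j) <= q%:E)%E ->
  (mu (\big[setU/set0]_(k < N) gap (2 * e)%R m (m + k)) <= (2 * q)%:E)%E.
Proof.
move=> q2 Sq.
pose A k := gap (2 * e) m (m + k).
pose D k := ~` gap e (m + k) (m + N).
pose B := gap e m (m + N).
have mA k : measurable (A k) by exact: measurable_gap.
have mD k : measurable (D k) by apply: measurableC; exact: measurable_gap.
have mB : measurable B by exact: measurable_gap.
have : ((2^-1)%:E * mu (\big[setU/set0]_(k < N) A k) <= mu B)%E.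
  apply: (first_passage_bound (D := D)) => //.
  - move=> k kN; pose J := [set i | (i <= m + k)%N].
    pose J' := [set i | (m + k < i)%N].
    apply: (independent_blocks indX (A := J) (A' := J')).
    + by apply/seteqP; split=> // i []; rewrite /J /J' /=; lia.
    + have pA l : (l <= k)%N -> <<s cylinders X_ J >> (A l).
        by move=> lk; apply: past_increment; rewrite ?leq_addr ?leq_add2l.
      rewrite /seqDU -bigcup_mkord.
      apply: (@measurableD _ (block J)); first exact: pA.
      apply: bigcup_measurable => l /= /ltnW; exact: pA.
    + apply: (@measurableC _ (block J')).
      rewrite (_ : m + N = (m + k).+1 + (N - k.+1))%N; last by lia.
      exact: future_increment.
  - move=> k kN w []; rewrite /A /D /B /gap /= => Ak /negP.
    rewrite -leNgt => Dk.
    have := metric_triangle (S m w) (S (m + N)%N w) (S (m + k)%N w).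
    rewrite (metric_sym (S (m + N)%N w)); lra.
  - move=> k kN; rewrite probability_setC //.
    have := Sq (m + k)%N (m + N)%N (leq_addr _ _) (leq_addr _ _).
    have := fin_num_measure mu _ (measurable_gap e (m + k) (m + N)).
    move=> /fineK <-; rewrite -EFinB !lee_fin; lra.
have mU : measurable (\big[setU/set0]_(k < N) A k) by exact: bigsetU_measurable.
have := Sq m (m + N)%N (leqnn _) (leq_addr _ _).
rewrite -(fineK (fin_num_measure mu _ mU)) => Bq /le_trans/(_ Bq).
rewrite -EFinM !lee_fin; lra.
Qed.

(** If [S] is [3e]-far from [X] at some time after [m], then it is [e/2]-far
    from [X] at time [m] or has moved by more than [2e] since then. Convergence in
    probability controls the first event, Ottaviani's inequality the second. *)
Lemma cvg_in_probability_almost_surely (X : Omega -> G) : borel_map X ->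
  cvg_in_probability mu S X -> cvg_almost_surely mu S X.
Proof.
move=> mX SX.
have mfar n e : measurable [set w | e < mdist (S n w) (X w)].
  exact: measurable_mdist_gt.
apply: cvg_almost_surely_limsup0 => // e3 e30.
pose e := e3 / 3; have e0 : 0 < e by rewrite divr_gt0.
have e3E : e3 = 3 * e by rewrite /e; lra.
pose far n := [set w | e / 2 < mdist (S n w) (X w)].
set L := \bigcap_m _.
have mL : measurable L.
  by apply: bigcapT_measurable => m; apply: bigcup_measurable => k _; exact: mfar.
(* [q <= 1/4] because displacements are at most [e] up to probability [2q],
   which Ottaviani's inequality needs to be at most [1/2] *)
have Lq (q : R) : 0 < q -> q <= 4^-1 -> (mu L <= (5 * q)%:E)%E.
  move=> q0 q4.
  have [m _ mq] : \forall n \near \oo, (mu (far n) < q%:E)%E.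
    have e20 : 0 < e / 2 by exact: divr_gt0.
    apply: (SX _ e20 [set y | (y < q%:E)%E]).
    exact: (nbhs_open_ereal_lt (f := fun=> q)).
  have mgap : forall e i j, measurable (gap e i j) by exact: measurable_gap.
  have gapq i j : (m <= i)%N -> (m <= j)%N -> (mu (gap e i j) <= (2 * q)%:E)%E.
    move=> mi mj; apply: (@le_trans _ _ (mu (far i `|` far j))).
      apply: le_measure; rewrite ?inE.
      - exact: mgap.
      - by apply: measurableU; exact: mfar.
      move=> w; rewrite /gap /far /= => eij.
      have := metric_triangle (S i w) (X w) (S j w).
      rewrite (metric_sym (X w)).
      have [|] := ltP (e / 2) (mdist (S i w) (X w)); first by left.
      by have [|] := ltP (e / 2) (mdist (S j w) (X w)); [right|lra].
    apply: le_trans (measureU2 _ (mfar _ _) (mfar _ _)) _.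
    have -> : (2 * q = q + q)%R by lra.
    by rewrite EFinD; apply: leeD; apply/ltW/mq.
  have Uq : (mu (\bigcup_k gap (2 * e)%R m (m + k)) <= (4 * q)%:E)%E.
    apply: measure_bigcup_le => // N.
    have -> : (4 * q = 2 * (2 * q))%R by lra.
    by apply: ottaviani => //; lra.
  apply: (@le_trans _ _ (mu (far m `|` \bigcup_k gap (2 * e)%R m (m + k)))).
    apply: le_measure; rewrite ?inE //.
      by apply: measurableU; [exact: mfar|exact: bigcup_measurable].
    move=> w /(_ m I)[k _ /= ek].
    have := metric_triangle (S (m + k)%N w) (S m w) (X w).
    rewrite (metric_sym (S (m + k)%N w) (S m w)) => tri.
    have [|] := ltP (e / 2) (mdist (S m w) (X w)); first by left.
    by move=> h; right; exists k => //; rewrite /gap /=; lra.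
  apply: le_trans (measureU2 _ (mfar _ _) _) _; first exact: bigcup_measurable.
  have -> : (5 * q = q + 4 * q)%R by lra.
  by rewrite EFinD; apply: leeD => //; apply/ltW/mq => /=.
apply/eqP; rewrite eq_le measure_ge0 andbT; apply/lee_addgt0Pr => r r0.
rewrite add0e; pose q : R := Num.min (r / 5) 4^-1.
have q5 : 5 * q <= r by have : q <= r / 5 by [rewrite /q ge_min lexx]; lra.
apply: le_trans (Lq q _ _) _; rewrite ?lee_fin //.
- by rewrite /q lt_min divr_gt0 //= invr_gt0.
- by rewrite /q ge_min lexx orbT.
Qed.

Let C := [set w | cauchy_sequence (S ^~ w)].

(** For every [n] the event [C] is also the Cauchy event of the products
    starting at [X_ n.+1]: it is a tail event. *)
Lemma cauchy_zero_one : mu C = 0%E \/ mu C = 1%E.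
Proof.
apply: (kolmogorov_zero_one indX) => n.
have -> : C = [set w | cauchy_sequence (fun j => tail n j w)].
  apply/seteqP; split=> w; rewrite /C /mkset.
    by move=> /(@cauchy_prefix_prod_shift _ _ _ n).
  by move=> ?; apply/(@cauchy_prefix_prod_shift _ _ _ n).
have := @measurable_cauchy _ (block [set i | (n < i)%N]) _ _
  (fun j => tail n j) sepG (fun j => @block_tail n j).
by apply: sub_sigma_algebra2; apply: sub_cylinders => i /= /ltnW.
Qed.

Lemma diverges_almost_surely_without_limit :
  ~ (exists Y : {RV mu >-> borelType G}, cvg_almost_surely mu S Y) ->
  diverges_almost_surely mu S.
Proof.
move=> noY; have mC : measurable C by exact: measurable_cauchy.
have [C0|C1] := cauchy_zero_one.
  apply: (@negligibleS _ _ _ mu C); last by apply/negligibleP.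
  by move=> w /contrapT/cauchy_sequenceP.
absurd_not => _; apply: noY.
(* if [C] has probability 1, the limit on [C], extended by a constant, is a
   random variable *)
have /choice[Y YP] : forall w, exists y : G,
    (C w -> S n w @[n --> \oo] --> y) /\ (~ C w -> y = point).
  move=> w; have [Cw|nCw] := pselect (C w).
    by have /cauchy_sequenceP[l Sl] := Cw; exists l.
  by exists point.
have mY : borel_map Y.
  pose Z n w := if w \in C then S n w else point.
  apply: (borel_map_lim sepG (f := Z)) => [n|w].
    move=> U oU.
    have -> : Z n @^-1` U = (C `&` S n @^-1` U) `|` (~` C `&` cst point @^-1` U).
      apply/seteqP; split=> w; rewrite /Z /=.
        by case: ifPn; [rewrite inE; left|rewrite notin_setE; right].
      by case=> -[Cw]; [rewrite mem_set|rewrite memNset].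
    apply: measurableU; apply: measurableI => //; [exact: mS|exact: measurableC|].
    by rewrite preimage_cst; case: ifP.
  have [SY Y0] := YP w.
  have [Cw|nCw] := pselect (C w).
    have -> : Z ^~ w = S ^~ w by apply/funext => n; rewrite /Z mem_set.
    exact: SY.
  have -> : Z ^~ w = cst (Y w).
    by apply/funext => n; rewrite /Z memNset //= Y0.
  exact: cvg_cst.
have {}mY : measurable_fun setT (Y : Omega -> borelType G).
  exact/measurable_fun_borelP.
pose Y' : {RV mu >-> borelType G} :=
  HB.pack Y (isMeasurableFun.Build _ _ _ _ _ mY).
exists Y'.
apply: (@negligibleS _ _ _ mu (~` C)).
  move=> w /= nS Cw; apply: nS; exact: (YP w).1.
have C0 : mu (~` C) = 0%E by rewrite probability_setC // C1 subee.
by apply/negligibleP => //; exact: measurableC.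
Qed.

End random_products.

Theorem theorem2p1 (R : realType) (G : completeMetricSemigroupType R)
    (d : measure_display) (Omega : measurableType d) (mu : probability Omega R)
    (X_ : nat -> {RV mu >-> borelType G}) :
  separable G ->
  mutually_independent X_ ->
  let S := fun n w => prefix_prod (fun k => X_ k w : G) n in
  (forall X : {RV mu >-> borelType G},
     cvg_almost_surely mu S X <-> cvg_in_probability mu S X) /\
  (~ (exists Y : {RV mu >-> borelType G}, cvg_almost_surely mu S Y) ->
   diverges_almost_surely mu S).
Proof.
move=> sepG indX S; split; last exact: diverges_almost_surely_without_limit.
move=> X.
have mX : borel_map (X : Omega -> G).
  by apply/measurable_fun_borelP; exact: measurable_funPT.
have mX_ i : borel_map (X_ i : Omega -> G).
  by apply/measurable_fun_borelP; exact: measurable_funPT.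
have mS n : borel_map (S n) by exact: borel_map_prefix_prod.
split; last exact: cvg_in_probability_almost_surely.
by apply: cvg_almost_surely_in_probability => n e; exact: measurable_mdist_gt.
Qed.
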